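(* Let $k$ be a commutative ring, let $\mathcal{D}$ be a small category, and let $\mu$ be a homological modulus for $\mathcal{D}$ over $k$ (the sets $\mu(d)$ are not required to be finite). Let $\{d_i\}_{i\in I}$ be a (possibly infinite) family of objects of $\mathcal{D}$. If a representation $V$ of $\mathcal{D}$ over $k$ is generated in degrees $\{d_i\}_{i\in I}$, then any subrepresentation of $V$ is generated in degrees $\mu(\{d_i\}_{i\in I})=\bigcup_{i\in I}\mu(d_i)$.
   Context: A representation of $\mathcal{D}$ over $k$ is a functor $V:\mathcal{D}\to\mathrm{Mod}_k$; maps are natural transformations, and subrepresentations are formed objectwise. $V$ is generated in degrees $\{d_i\}_{i\in I}$ if any subrepresentation $W\subseteq V$ with $W(d_i)=V(d_i)$ for all $i\in I$ equals $V$ (and similarly for a set of objects in place of a family). For objects $x,y\in\mathcal{D}$, let $S(x,y)$ be the set of morphisms $x\to x$ that factor through $y$. For $d\in\mathcal{D}$ and $s\in S(x,y)$, let $M_s$ be the square $0$-$1$ matrix over $k$ with rows and columns indexed by $\operatorname{Hom}_{\mathcal{D}}(d,x)$, whose $(f,g)$ entry is $1$ if $s\circ f=g$ and $0$ otherwise. Write $x\leq_d y$ if the identity matrix lies in the $k$-span (finite $k$-linear combinations) of the matrices $M_s$, $s\in S(x,y)$. In this statement a homological modulus for $\mathcal{D}$ over $k$ is a function $\mu$ from objects of $\mathcal{D}$ to (not necessarily finite) subsets of $\operatorname{Ob}(\mathcal{D})$ such that for every $d,x\in\mathcal{D}$ there exists $y\in\mu(d)$ with $x\leq_d y$. No finiteness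 of hom-sets and no Artinian hypothesis on $k$ is assumed. *)

(* Defs.v *)
From HB Require Import structures.
From mathcomp Require Import all_boot all_algebra.
From mathcomp Require Import boolp classical_sets functions.

Set Implicit Arguments.
Unset Strict Implicit.
Unset Printing Implicit Defensive.

Import GRing.Theory.
Local Open Scope classical_set_scope.
Local Open Scope ring_scope.

Record category := Category {
  ob :> Type;
  mor : ob -> ob -> Type;
  cat_id : forall x, mor x x;
  cat_comp : forall x y z, mor y z -> mor x y -> mor x z;
  cat_comp1m : forall x y (f : mor x y), cat_comp (cat_id y) f = f;
  cat_compm1 : forall x y (f : mor x y), cat_comp f (cat_id x) = f;
  cat_compA : forall x y z w (h : mor z w) (g : mor y z) (f : mor x y),
    cat_comp h (cat_comp g f) = cat_comp (cat_comp h g) f }.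

(* No finType or eqType is assumed on hom-sets, so a matrix indexed by them is
   a function of two arguments; k^o (the regular module) makes the space of
   such matrices an lmodType k with entrywise operations. *)
Notation mor_mx k d x := (mor d x -> mor d x -> k^o).

Section Modulus.
Variables (k : comPzRingType) (D : category).

Definition factors_through (x y : D) : set (mor x x) :=
  [set s | exists (p : mor x y) (q : mor y x), s = cat_comp q p].

Definition comp_mx (d x : D) (s : mor x x) : mor_mx k d x :=
  fun f g => (`[< cat_comp s f = g >])%:R.

Definition id_mx (d x : D) : mor_mx k d x := fun f g => (`[< f = g >])%:R.

Definition lin_span (M : lmodType k) (A : set M) : set M :=
  [set v | exists (n : nat) (c : 'I_n -> k) (a : 'I_n -> M),
     (forall i, A (a i)) /\ v = \sum_(i < n) c i *: a i].

Definition le_at (d x y : D) : Prop :=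
  lin_span (@comp_mx d x @` @factors_through x y) (@id_mx d x).

Definition homological_modulus (mu : D -> set D) : Prop :=
  forall d x : D, exists2 y, mu d y & le_at d x y.

End Modulus.

Record representation (k : comPzRingType) (D : category) := Representation {
  rep_ob :> D -> lmodType k;
  rep_map : forall x y, mor x y -> {linear rep_ob x -> rep_ob y};
  rep_map1 : forall x v, rep_map (cat_id x) v = v;
  rep_mapM : forall x y z (g : mor y z) (f : mor x y) v,
    rep_map (cat_comp g f) v = rep_map g (rep_map f v) }.

Record subrepresentation (k : comPzRingType) (D : category)
    (V : representation k D) := Subrepresentation {
  subrep_ob :> forall x, submodClosed (V x);
  subrep_map : forall x y (f : mor x y) v,
    v \in subrep_ob x -> rep_map V f v \in subrep_ob y }.

(* The submodule S of M as a module in its own right. *)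
Record submod (k : pzRingType) (M : lmodType k) (S : submodClosed M) :=
  Submod { submod_val : M; _ : submod_val \in S }.

Section SubmodLmodule.
Variables (k : pzRingType) (M : lmodType k) (S : submodClosed M).
HB.instance Definition _ := [isSub for @submod_val k M S].
HB.instance Definition _ := [Choice of submod S by <:].
HB.instance Definition _ := [SubChoice_isSubLmodule of submod S by <:].
End SubmodLmodule.

(* A subrepresentation of V as a representation in its own right. *)
Section SubrepRep.
Variables (k : comPzRingType) (D : category) (V : representation k D).
Variable W : subrepresentation V.

Definition subrep_fun x y (f : mor x y) (w : submod (W x)) : submod (W y) :=
  Submod (subrep_map f (valP w)).

Fact subrep_fun_is_linear x y (f : mor x y) : linear (subrep_fun f).
Proof. by move=> a u v; apply: val_inj; rewrite /= !linearP. Qed.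

HB.instance Definition _ x y (f : mor x y) :=
  GRing.isLinear.Build k (submod (W x)) (submod (W y)) _ (subrep_fun f)
    (subrep_fun_is_linear f).

Fact subrep_fun1 x w : subrep_fun (cat_id x) w = w.
Proof. by apply: val_inj; rewrite /= rep_map1. Qed.

Fact subrep_funM x y z (g : mor y z) (f : mor x y) w :
  subrep_fun (cat_comp g f) w = subrep_fun g (subrep_fun f w).
Proof. by apply: val_inj; rewrite /= rep_mapM. Qed.

Definition rep_of_subrep : representation k D :=
  @Representation k D (fun x => submod (W x))
    (fun x y f => subrep_fun f) subrep_fun1 subrep_funM.

End SubrepRep.

(* A family of degrees d_i, i : I, is passed as the set range d. *)
Definition generated_in (k : comPzRingType) (D : category)
    (V : representation k D) (P : set D) : Prop :=
  forall W : subrepresentation V,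
    (forall x, P x -> forall v : V x, v \in W x) ->
    forall x (v : V x), v \in W x.

(* Main.v *)
Require Import Defs.
From HB Require Import structures.
From mathcomp Require Import all_boot all_algebra.
From mathcomp Require Import boolp classical_sets functions.

(** A formal linear combination [t] of endomorphisms of [x] acts on [V x] for
    every representation [V], compatibly with subrepresentations. The relation
    [le_at k d x y] says exactly that some [e], all of whose terms factor
    through [y], fixes every morphism from [d] to [x] in the free module on
    these morphisms; hence in every [V] it fixes the images in [V x] of the
    elements of [V d] ([le_at_fixing]). So [1 - e] annihilates these images,
    while it is congruent to [1] modulo any subrepresentation that is everything
    at [y].

    Let [U] be a subrepresentation of [W] that is everything on the degrees
    [mu (d i)]. An element of [W x] is a sum of images of elements of finitely
    many [V (d i)]; a product of the corresponding operators [1 - e] annihilates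
    it, and is congruent to [1] modulo [U] on [W x], so the element lies in [U].

    The operators [1 - e] need not commute: applying one of them to an image of
    [v] gives a combination of several images of [v], which the next operators
    must still kill. This is why [v] is called absorbable when, for every formal
    combination [t] out of its degree, some operator congruent to [1] modulo [U]
    kills [t v]. The absorbable elements then form a subrepresentation of [V]
    ([absorbable_subrep]), which contains each [V (d i)] ([absorbable_degree])
    and is thus all of [V]; taking for [t] the identity gives the theorem
    ([absorbable_in]). *)

Set Implicit Arguments.
Unset Strict Implicit.
Unset Printing Implicit Defensive.

Import GRing.Theory.

Section Main.
Local Open Scope classical_set_scope.
Local Open Scope ring_scope.
Variables (k : comPzRingType) (D : category).

(** Lists of terms suffice in place of the free module on [mor x y], since only
    their actions on representations are ever compared. *)
Definition lin_mor (x y : D) := seq (k * mor x y).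

Definition act (V : representation k D) x y (t : lin_mor x y) (v : V x) : V y :=
  \sum_(p <- t) p.1 *: rep_map V p.2 v.

Definition lin_comp x y z (t : lin_mor y z) (u : lin_mor x y) : lin_mor x z :=
  [seq (p.1 * q.1, cat_comp p.2 q.2) | p <- t, q <- u].

Definition one_sub x (t : lin_mor x x) : lin_mor x x :=
  (1, cat_id x) :: [seq (- p.1, p.2) | p <- t].

Section Act.
Variable V : representation k D.

Lemma act_is_linear x y (t : lin_mor x y) : linear (act (V := V) t).
Proof.
move=> a u v; rewrite /act scaler_sumr -big_split /=.
by apply: eq_bigr => p _; rewrite linearP scalerDr !scalerA mulrC.
Qed.

HB.instance Definition _ x y (t : lin_mor x y) :=
  GRing.isLinear.Build k (V x) (V y) _ (act (V := V) t) (act_is_linear t).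

Lemma act_mor x y (f : mor x y) (v : V x) : act [:: (1, f)] v = rep_map V f v.
Proof. by rewrite /act big_seq1 scale1r. Qed.

Lemma act_lin_comp x y z (t : lin_mor y z) (u : lin_mor x y) (v : V x) :
  act (lin_comp t u) v = act t (act u v).
Proof.
rewrite /act /lin_comp big_allpairs_dep; apply: eq_bigr => p _.
rewrite linear_sum scaler_sumr; apply: eq_bigr => q _ /=.
by rewrite rep_mapM linearZ /= scalerA.
Qed.

Lemma act_one_sub x (t : lin_mor x x) (v : V x) :
  act (one_sub t) v = v - act t v.
Proof.
rewrite /act /one_sub big_cons scale1r rep_map1 big_map -sumrN; congr (_ + _).
by apply: eq_bigr => p _; rewrite scaleNr.
Qed.

Lemma val_act_rep_of_subrep (W : subrepresentation V) x y (t : lin_mor x y)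
  (w : submod (W x)) :
  val (act (V := rep_of_subrep W) t w) = act t (val w).
Proof. by rewrite /act raddf_sum. Qed.

End Act.

(** The equation between coefficients says that [\sum_i c i * g i = f] in the
    free module on [T]; it is carried to [M] by the linear extension of [F]. *)
Lemma free_lift (T : Type) (M : lmodType k) (F : T -> M) n (c : 'I_n -> k)
    (g : 'I_n -> T) (f : T) :
  (forall h, \sum_i c i * (`[< g i = h >])%:R = (`[< f = h >])%:R) ->
  \sum_i c i *: F (g i) = F f.
Proof.
move=> cg; pose s := undup (f :: codom g : seq {classic T}).
have sum_delta h : h \in s -> \sum_(e <- s) (`[< h = e >])%:R *: F e = F h.
  move=> sh; rewrite (bigD1_seq h) ?undup_uniq //= asboolT // scale1r.
  rewrite big1 ?addr0 // => e /eqP neq_eh.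
  by rewrite asboolF ?scale0r // => /esym.
rewrite -(sum_delta f) ?mem_undup ?mem_head //.
under [RHS]eq_bigr do rewrite -cg scaler_suml.
rewrite exchange_big; apply: eq_bigr => i _ /=.
rewrite -(sum_delta (g i)) ?mem_undup ?inE ?codom_f ?orbT //.
by rewrite scaler_sumr; apply: eq_bigr => e _; rewrite scalerA.
Qed.

(** [Hom(d, -)] is the universal case: the matrix identity says that [e] fixes
    each [f : mor d x] in the free module on [mor d x], and the linear map
    sending [g] to [rep_map V g v] transports this to [V x]. Factoring through
    [y] forces the values of [e] into the subrepresentation generated by
    [V y]. *)
Lemma le_at_fixing d x y : le_at k d x y ->
  exists e : lin_mor x x,
    (forall (V : representation k D) (f : mor d x) (v : V d),
       act e (rep_map V f v) = rep_map V f v) /\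
    (forall (V : representation k D) (U : subrepresentation V),
       (forall v : V y, v \in U y) -> forall v : V x, act e v \in U x).
Proof.
move=> [n [c [a [aP id_sum]]]].
have /choice[s sP] : forall i, exists s, factors_through y s /\ comp_mx k s = a i.
  by move=> i; have [s sxy sE] := aP i; exists s.
exists [seq (c i, s i) | i <- index_enum 'I_n]; split=> [V f v | V U Uy v].
  rewrite /act big_map.
  under eq_bigr do rewrite -rep_mapM.
  apply: (free_lift (fun g => rep_map V g v)) => h.
  have /(congr1 (fun M => M f h)) := id_sum.
  rewrite /id_mx => ->; rewrite !fct_sumE.
  by apply: eq_bigr => i _; rewrite -(sP i).2.
rewrite /act big_map; apply: rpred_sum => i _; apply: rpredZ => /=.
by have [[p [q ->]] _] := sP i; rewrite rep_mapM; apply: subrep_map.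
Qed.

(** [t] acts as the identity on the quotient [V x / U x]. *)
Definition one_mod V (U : subrepresentation V) x (t : lin_mor x x) :=
  forall v : V x, v - act t v \in U x.

Lemma one_mod_comp V (U : subrepresentation V) x (t u : lin_mor x x) :
  one_mod U t -> one_mod U u -> one_mod U (lin_comp t u).
Proof.
move=> tU uU v; rewrite act_lin_comp.
by rewrite -(subrKA (act u v)) rpredD.
Qed.

Section Absorbable.
Variables (V : representation k D) (W : subrepresentation V).
Variable U : subrepresentation (rep_of_subrep W).

(** An element of [W x] killed by an operator congruent to [1] modulo [U] lies
    in [U x]; being killed, unlike being in [U x], makes sense on all of [V x],
    where the generation hypothesis applies.
    Quantifying over all targets [z] and all [t] makes the absorbable elements
    stable under morphisms and under sums. *)
Definition absorbable x : {pred V x} := fun v =>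
  `[< forall z (t : lin_mor x z),
        exists2 e : lin_mor z z, one_mod U e & act e (act t v) = 0 >].

Lemma absorbable_closed x : subsemimod_closed (@absorbable x).
Proof.
split; first split.
- apply/asboolP => z t; exists [:: (1, cat_id z)]; last by rewrite !linear0.
  by move=> w; rewrite act_mor rep_map1 subrr rpred0.
- move=> u v /asboolP u_abs /asboolP v_abs; apply/asboolP => z t.
  have [e eU eu0] := u_abs z t.
  (* e kills t u, and e' kills e t v: then e' e kills both t u and t v. *)
  have [e' e'U ev0] := v_abs z (lin_comp e t).
  exists (lin_comp e' e); first exact: one_mod_comp.
  by rewrite act_lin_comp !linearD /= eu0 linear0 add0r -(act_lin_comp e).
- move=> a v /asboolP v_abs; apply/asboolP => z t.
  by have [e eU ev0] := v_abs z t; exists e; rewrite // !linearZ /= ev0 scaler0.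
Qed.

HB.instance Definition _ x :=
  GRing.isSubSemiModClosed.Build k (V x) (@absorbable x) (@absorbable_closed x).

Lemma absorbable_map x y (f : mor x y) (v : V x) :
  v \in @absorbable x -> rep_map V f v \in @absorbable y.
Proof.
move=> /asboolP v_abs; apply/asboolP => z t.
have [e eU ev0] := v_abs z (lin_comp t [:: (1, f)]).
by exists e; rewrite // -act_mor -(act_lin_comp t).
Qed.

Definition absorbable_subrep : subrepresentation V :=
  @Subrepresentation k D V (fun x => @absorbable x) absorbable_map.

(** Every [t v] with [v] in degree [d] is a combination of images of [v], so a
    single [e] for the pair [d], [z] fixes it, whatever [t] is. *)
Lemma absorbable_degree (mu : D -> set D) (d : D) (v : V d) :
  homological_modulus k mu ->
  (forall y, mu d y -> forall w : rep_of_subrep W y, w \in U y) ->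
  v \in absorbable_subrep d.
Proof.
move=> hmu Umu; apply/asboolP => z t.
have [y mu_y /le_at_fixing[e [e_fix eU]]] := hmu d z.
exists (one_sub e).
  move=> w; rewrite act_one_sub opprB addrCA subrr addr0 eU // => w'.
  exact: Umu.
suff -> : act (one_sub e) (act t v) = \sum_(p <- t) 0 by rewrite big1_eq.
rewrite {2}/act linear_sum; apply: eq_bigr => p _.
by rewrite linearZ /= act_one_sub e_fix subrr scaler0.
Qed.

Lemma absorbable_in x (w : rep_of_subrep W x) :
  val w \in absorbable_subrep x -> w \in U x.
Proof.
move=> /asboolP/(_ x [:: (1, cat_id x)])[e eU].
rewrite act_mor rep_map1 -val_act_rep_of_subrep => ew0.
have -> : w = w - act e w; last exact: eU.
suff -> : act e w = 0 by rewrite subr0.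
exact: val_inj.
Qed.

End Absorbable.
End Main.

Local Open Scope classical_set_scope.

Theorem corollary1p11 (k : comPzRingType) (D : category) (mu : D -> set D)
    (hmu : homological_modulus k mu) (I : Type) (d : I -> D)
    (V : representation k D) (hV : generated_in V (range d))
    (W : subrepresentation V) :
  generated_in (rep_of_subrep W) (\bigcup_(i in [set: I]) mu (d i)).
Proof.
move=> U Umu x w; apply: absorbable_in.
apply: (hV (absorbable_subrep U)) => _ [i _ <-] v.
by apply: (absorbable_degree v hmu) => y mu_y; apply: Umu; exists i.
Qed.
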